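(* Let $n\geq 2$ and let $f:\mathbb{R}^n\to\mathbb{R}$ be defined by $f(x_1,\dots,x_n)=\alpha(x_1)$, where $\alpha:\mathbb{R}\to[0,\infty)$ is a $C^\infty$ convex function such that $\alpha(t)=0$ for $|t|\leq 1$ and $\alpha(t)=|t|-2$ for $|t|\geq 3$. Let $\varepsilon:\mathbb{R}^n\to(0,\infty)$ be continuous and such that $\lim_{|x|\to\infty}\varepsilon(x)=0$. Then there is no real analytic convex function $g:\mathbb{R}^n\to\mathbb{R}$ such that $|f(x)-g(x)|\leq\varepsilon(x)$ for all $x\in\mathbb{R}^n$.
   Context: All notions are standard. *)

(* Defs.v *)
From HB Require Import structures.
From mathcomp Require Import all_boot all_order all_algebra finmap.
From mathcomp Require Import all_classical all_reals all_analysis.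
From mathcomp.analysis.showcase Require Import summability.

Set Implicit Arguments.
Unset Strict Implicit.
Unset Printing Implicit Defensive.

Import Order.TTheory GRing.Theory Num.Theory.
Import numFieldNormedType.Exports.

Local Open Scope classical_set_scope.
Local Open Scope ring_scope.

(* The library norm `|x| on 'rV[R]_n is the sup norm; this is the Euclidean
   one. *)
Definition enorm (R : realType) (n : nat) (x : 'rV[R]_n) : R :=
  Num.sqrt (\sum_(i < n) x 0 i ^+ 2).

(* The filter "|x| --> oo" on R^n. *)
Definition at_infinity (R : realType) (n : nat) : set_system 'rV[R]_n :=
  filter_from [set: R] (fun M => [set x | M < enorm x]).

Arguments at_infinity : clear implicits.

Definition smooth (R : realType) (f : R -> R) : Prop :=
  forall (k : nat) (t : R), derivable (derive1n k f) t 1.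

Definition monomial (R : realType) (n : nat) (h : 'rV[R]_n)
    (m : {ffun 'I_n -> nat}) : R :=
  \prod_(i < n) h 0 i ^+ m i.

(* Multi-index series are summed unconditionally: the finite partial sums
   converge along the directed set of finite sets of multi-indices. *)
Definition analytic_at (R : realType) (n : nat) (g : 'rV[R]_n -> R)
    (a : 'rV[R]_n) : Prop :=
  exists c : {ffun 'I_n -> nat} -> R,
    \forall x \near a,
      partial_sum (fun m => c m * monomial (x - a) m) @ totally --> g x.

Definition real_analytic (R : realType) (n : nat) (g : 'rV[R]_n -> R) : Prop :=
  forall a : 'rV[R]_n, analytic_at g a.

(* Main.v *)
Require Import Defs.
From HB Require Import structures.
From mathcomp Require Import all_boot all_order all_algebra.
From mathcomp Require Import all_classical all_reals all_analysis.
From mathcomp Require Import finmap ring lra.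
From mathcomp.analysis.showcase Require Import summability.

Set Implicit Arguments.
Unset Strict Implicit.
Unset Printing Implicit Defensive.

Import Order.TTheory GRing.Theory Num.Theory.
Import numFieldNormedType.Exports.

Local Open Scope classical_set_scope.
Local Open Scope ring_scope.

(** On a line parallel to the second coordinate axis f is constant and g - f
    tends to 0 at both ends, so the restriction of g is convex with equal
    finite limits at both ends; hence it is constant, and g coincides with f on
    the first axis.  Thus alpha would be locally the sum of a power series at
    every point; being 0 on [0, 1], it would vanish on [0, +oo[ by the identity
    principle, whereas alpha 4 = 2. *)

Lemma convex_function_midpoint (R : realType) (E : lmodType R) (g : E -> R) :
  @convex_function R E [set: E] g ->
  forall x y, g (2^-1 *: x + 2^-1 *: y) <= 2^-1 * g x + 2^-1 * g y.
Proof.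
move=> cg x y.
have h01 : 0 <= (2^-1 : R) <= 1 by apply/andP; split; lra.
have onem2 : unstable.onem (2^-1 : R) = 2^-1 by rewrite /unstable.onem; lra.
rewrite -[X in X *: y]onem2 -[X in _ + X * g y]onem2.
exact: (cg (Itv01 (proj1 (andP h01)) (proj2 (andP h01))) x y
  (mem_set I) (mem_set I)).
Qed.

(** For [s] large, the midpoint of [s] and [- s] bounds [phi 0] above by nearly [l]. The midpoint of
    [0] and [2 * s] gives [phi 0 >= 2 * phi s - phi (2 * s)], nearly [l] from below; its three
    errors account for [e / 3]. *)
Lemma midpoint_convex_eq_limit (R : realType) (phi : R -> R) (l : R) :
  (forall s t, phi (2^-1 * s + 2^-1 * t) <= 2^-1 * phi s + 2^-1 * phi t) ->
  (forall e, 0 < e -> exists M, forall s, M < `|s| -> `|l - phi s| <= e) ->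
  phi 0 = l.
Proof.
move=> cphi lphi; apply/eqP; rewrite -subr_eq0 -normr_le0.
apply/ler_addgt0Pr => e e0; rewrite add0r.
have [M HM] := lphi (e / 3) ltac:(by rewrite divr_gt0).
pose s : R := `|M| + 1.
have sM : M < s by rewrite /s (le_lt_trans (ler_norm M))// ltrDl.
have s0 : 0 < s by rewrite /s ltr_wpDl.
have := HM s; rewrite gtr0_norm// => /(_ sM); rewrite ler_norml => /andP[a1 a2].
have := HM (- s); rewrite normrN gtr0_norm// => /(_ sM).
rewrite ler_norml => /andP[b1 b2].
have := HM (2 * s); rewrite gtr0_norm; last by lra.
move=> /(_ ltac:(lra)); rewrite ler_norml => /andP[c1 c2].
have := cphi s (- s); rewrite mulrN subrr => u1.
have := cphi 0 (2 * s); rewrite mulr0 add0r mulrA mulVf ?pnatr_eq0// mul1r => u2.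
by rewrite ler_norml; apply/andP; split; lra.
Qed.

Lemma ler_coord_enorm (R : realType) (n : nat) (x : 'rV[R]_n) (i : 'I_n) :
  `|x 0 i| <= enorm x.
Proof.
rewrite /enorm -sqrtr_sqr ler_wsqrtr// (bigD1 i)//= lerDl.
by apply: sumr_ge0 => j _; exact: sqr_ge0.
Qed.

(** The induction step is [q ^+ N + 2 * q ^+ N.+1 <= 2 * q ^+ N], which is where [q <= 2^-1]
    enters. *)
Lemma geometric_tail_le (R : realType) (q : R) (N K : nat) :
  0 <= q <= 2^-1 -> \sum_(k < K) q ^+ (N + k) <= 2 * q ^+ N.
Proof.
move=> /andP[q0 q1]; elim: K N => [|K IH] N.
  by rewrite big_ord0 mulr_ge0// exprn_ge0.
rewrite big_ord_recl addn0; under eq_bigr do rewrite /= /bump addnA.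
apply: le_trans (lerD (lexx _) (IH (N + 1)%N)) _.
rewrite exprD expr1; have := exprn_ge0 N q0; nra.
Qed.

Definition power_series_at (R : realType) (phi : R -> R) (a : R) : Prop :=
  exists d : nat -> R, \forall h \near (0 : R),
    series (fun k => d k * h ^+ k) @ \oo --> phi (a + h).

(* If d N is the first nonzero coefficient and |d m| r^m <= B for all m, then
   at h = - r q the N-th term has absolute value |d N| r^N q^N while the tail is
   at most 2 B q^(N+1), which is smaller for q small. *)
Lemma power_series_coef0 (R : realType) (d : nat -> R) (e : R) :
  0 < e ->
  (forall h, - e < h < 0 -> series (fun k => d k * h ^+ k) @ \oo --> (0 : R)) ->
  forall k, d k = 0.
Proof.
move=> e0 hd; apply: contrapT => /existsNP[k /eqP dk].
have [N dN minN] := ex_minnP (ex_intro (fun k => d k != 0) k dk).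
(* The series converges at [- r], so its terms there are bounded. *)
pose r := e / 2.
have r0 : 0 < r by rewrite divr_gt0.
have [B0 [_ /(_ (`|B0| + 1))]] :
    bounded_fun (fun k => d k * (- r) ^+ k).
  apply: cvg_series_bounded; apply/cvg_ex; exists 0; apply: hd.
  by apply/andP; split; rewrite /r; lra.
set B := `|B0| + 1.
move=> /(_ ltac:(by rewrite /B (le_lt_trans (ler_norm _))// ltrDl)) HB.
have {}HB m : `|d m| * r ^+ m <= B.
  by have /= := HB m I; rewrite normrM normrX normrN (gtr0_norm r0).
have B_gt0 : 0 < B by rewrite /B ltr_wpDl.
pose w := `|d N| * r ^+ N.
have w0 : 0 < w by rewrite mulr_gt0 ?exprn_gt0// normr_gt0.
(* With this choice the tail bound [2 * B * q ^+ N.+1] is exactly half of the [N]-th term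
   [w * q ^+ N]. *)
pose q := w / (4 * B).
have q0 : 0 < q by rewrite divr_gt0// mulr_gt0.
have qB : 4 * B * q = w by rewrite /q; field; rewrite gt_eqF.
have q1 : q <= 4^-1.
  by rewrite /q ler_pdivrMr ?mulr_gt0// mulrA mulVf ?pnatr_eq0// mul1r; exact: HB.
pose h := - (r * q).
have hnorm : `|h| = r * q by rewrite normrN gtr0_norm// mulr_gt0.
have hI : - e < h < 0.
  by apply/andP; split; rewrite /h /r; nra.
have term m : `|d m * h ^+ m| = `|d m| * r ^+ m * q ^+ m.
  by rewrite normrM normrX hnorm exprMn mulrA.
pose c := w * q ^+ N / 2.
have c0 : 0 < c by rewrite divr_gt0// mulr_gt0// exprn_gt0.
have /cvgrPdist_lt/(_ c c0)[K _ HK] := hd h hI.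
have := HK (N.+1 + K)%N (leq_addl _ _).
(* The partial sum splits into [N] zero terms, the [N]-th term and a tail [S] of [K] terms. The sum
   is below [c] and the tail at most [c], while the [N]-th term is [2 * c]. *)
rewrite sub0r normrN /series /= big_mkord big_split_ord /= big_ord_recr /=.
rewrite big1 ?add0r; last first.
  move=> i _; have [->|/minN] := eqVneq (d i) 0; first by rewrite mul0r.
  by rewrite leqNgt ltn_ord.
set S := \sum_(_ < _) _ => HS.
have S_le : `|S| <= 2 * B * q ^+ N.+1.
  apply: le_trans (ler_norm_sum _ _ _) _.
  rewrite [leRHS]mulrAC mulrC.
  apply: (@le_trans _ _ (B * \sum_(k < K) q ^+ (N.+1 + k))).
    rewrite mulr_sumr; apply: ler_sum => i _.
    by rewrite term ler_wpM2r// exprn_ge0// ltW.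
  rewrite ler_wpM2l ?(ltW B_gt0)//; apply: geometric_tail_le; lra.
have : w * q ^+ N < c + 2 * B * q ^+ N.+1.
  rewrite -(term N : _ = w * _) -{1}(addrK S (d N * _)).
  by rewrite (le_lt_trans (ler_normB _ _))// ltr_leD.
rewrite exprS /c -qB; have := exprn_gt0 N q0; nra.
Qed.

(** Let [s] be the supremum of the points up to which [phi] vanishes. The expansion at [s] is zero
    to the left of [s], so all its coefficients vanish and [phi] is zero beyond [s] as well. *)
Lemma power_series_identity (R : realType) (phi : R -> R) :
  (forall a, power_series_at phi a) ->
  (forall t, 0 <= t <= 1 -> phi t = 0) ->
  forall t, 0 <= t -> phi t = 0.
Proof.
move=> aphi phi01 t t0; apply: contrapT => phit.
pose S := [set s : R | 0 <= s /\ forall u, 0 <= u <= s -> phi u = 0].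
have S1 : S 1 by split.
have St : ubound S t.
  move=> s [s0 Hs]; rewrite leNgt; apply/negP => ts.
  by apply: phit; apply: Hs; rewrite t0 ltW.
have supS : has_sup S by split; [exists 1|exists t].
pose s := sup S.
have s1 : 1 <= s by exact: ub_le_sup (proj2 supS) _ S1.
have phis u : 0 <= u < s -> phi u = 0.
  move=> /andP[u0 us].
  have [v [_ Sv] uv] := sup_gt (proj1 supS) us.
  by apply: Sv; rewrite u0 ltW.
have [d /nbhs_ballP[e /= e0 He]] := aphi s.
have {}He h : `|h| < e -> series (fun k => d k * h ^+ k) @ \oo --> phi (s + h).
  by move=> he; apply: He; rewrite /ball /= sub0r normrN.
(* The bound 1 keeps [s + h] nonnegative, since [1 <= s]. *)
pose e' := Num.min e 1.
have e'0 : 0 < e' by rewrite lt_min e0 /=.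
have d0 : forall k, d k = 0.
  apply: (power_series_coef0 e'0) => h /andP[h1 h2].
  have /andP[he h11] : (- h < e) && (- h < 1) by rewrite -lt_min -/e' ltrNl.
  rewrite -(phis (s + h)); first by apply: He; rewrite ltr0_norm.
  by apply/andP; split; lra.
have phise h : `|h| < e -> phi (s + h) = 0.
  move=> /He; have -> : series (fun k => d k * h ^+ k) = cst 0.
    by apply/funext => K; rewrite /series /= big1// => k _; rewrite d0 mul0r.
  move=> phish; apply: (cvg_unique _ phish (cvg_cst 0)).
  exact: norm_hausdorff.
have : S (s + e / 2).
  split; first by have := divr_gt0 e0 (ltr0n _ 2); lra.
  move=> u /andP[u0 us]; have [us'|us'] := ltP u s; first by rewrite phis ?u0.
  by rewrite -(subrK s u) addrC phise// ger0_norm; lra.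
move=> /(ub_le_sup (proj2 supS)); rewrite -/s; lra.
Qed.

(** A nonzero exponent at some [j != i] contributes a factor 0; otherwise the other factors are
    [0 ^+ 0 = 1]. *)
Lemma monomial_delta (R : realType) (n : nat) (i : 'I_n) (h : R)
    (m : {ffun 'I_n -> nat}) :
  monomial (h *: delta_mx 0 i) m =
  if m == [ffun j => if j == i then m i else 0%N] then h ^+ m i else 0.
Proof.
rewrite /monomial (bigD1 i)//= !mxE !eqxx mulr1.
case: eqP => [mE|mNE].
  rewrite big1 ?mulr1// => j ji.
  by rewrite mE ffunE (negbTE ji) expr0.
have [j ji mj] : exists2 j, j != i & m j != 0%N.
  apply: contrapT => H; apply: mNE; apply/ffunP => j; rewrite ffunE.
  case: eqVneq => [->//|ji].
  by apply/eqP; apply: contrapT => /negP mj; apply: H; exists j.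
by rewrite (bigD1 j)//= !mxE (negbTE ji) andbF mulr0 expr0n (negbTE mj)
  mul0r mulr0.
Qed.

(** On the axis only the multi-indices [idx k] contribute, so unconditional summation yields
    convergence of the ordinary series with coefficients [c (idx k)]. *)
Lemma analytic_at_power_series (R : realType) (n : nat) (g : 'rV[R]_n -> R)
    (i : 'I_n) (a : R) :
  analytic_at g (a *: delta_mx 0 i) ->
  power_series_at (fun t => g (t *: delta_mx 0 i)) a.
Proof.
move=> [c hc]; set v : 'rV[R]_n := delta_mx 0 i in hc *.
pose idx (k : nat) := [ffun j => if j == i then k else 0%N] : {ffun 'I_n -> nat}.
have idx_i k : idx k i = k by rewrite ffunE eqxx.
exists (c \o idx).
have cv : (a + h) *: v @[h --> (0 : R)] --> a *: v.
  rewrite -[in X in _ --> X](addr0 a).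
  by apply: cvgZr_tmp; apply: cvgD; [exact: cvg_cst|exact: cvg_id].
have hc0 : \forall h \near (0 : R),
    partial_sum (fun m => c m * monomial ((a + h) *: v - a *: v) m) @ totally -->
    g ((a + h) *: v) := cv _ hc.
apply: filterS hc0 => h hg.
have {}hg : partial_sum (fun m => c m * monomial (h *: v) m) @ totally -->
    g ((a + h) *: v).
  by move: hg; rewrite scalerDl addrAC subrr add0r.
apply/cvgrPdist_lt => e e0.
have [F0 _ HF0] : totally _ := hg _ (nbhsx_ballx _ e e0).
(* Beyond this rank [G] contains every multi-index of [F0] supported at [i], so enlarging [G] by
   [F0] adds only zero terms. *)
exists (\max_(m <- F0) m i).+1 => // K /= K0.
pose G := [fset idx (val k) | k in 'I_K]%fset.
suff -> : series (fun k => (c \o idx) k * h ^+ k) K =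
    partial_sum (fun m => c m * monomial (h *: v) m) (F0 `|` G)%fset.
  by apply: HF0; exact: fsubsetUl.
rewrite /partial_sum -(big_seq_fsetE _ _ xpredT
  (fun m => c m * monomial (h *: v) m)).
rewrite -(@big_fset_incl _ _ _ _ G) ?fsubsetUr//; last first.
  move=> m; rewrite inE => /orP[mF0|->//]; rewrite monomial_delta.
  case: eqP => [mE /negP[]|]; last by rewrite mulr0.
  have mK : (m i < K)%N.
    apply: leq_trans K0; rewrite ltnS.
    exact: (@leq_bigmax_seq _ _ xpredT (fun m : {ffun 'I_n -> nat} => m i)).
  by apply/imfsetP; exists (Ordinal mK).
rewrite big_imfset/=; last first.
  move=> k l _ _ /(congr1 (fun m : {ffun 'I_n -> nat} => m i)).
  by rewrite !idx_i => /val_inj.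
rewrite /series /= big_mkord big_enum /=; apply: eq_bigr => k _.
by rewrite monomial_delta idx_i eqxx.
Qed.

Theorem mainTheorem8 (R : realType) (n : nat) (hn : (2 <= n)%N)
  (alpha : R -> R)
  (alpha_ge0 : forall t, 0 <= alpha t)
  (alpha_smooth : smooth alpha)
  (alpha_convex : @convex_function R R^o [set: R^o] alpha)
  (alpha_in : forall t, `|t| <= 1 -> alpha t = 0)
  (alpha_out : forall t, 3 <= `|t| -> alpha t = `|t| - 2)
  (f : 'rV[R]_n -> R)
  (hf : forall x, f x = alpha (x 0 (Ordinal (ltnW hn))))
  (eps : 'rV[R]_n -> R)
  (eps_gt0 : forall x, 0 < eps x)
  (eps_cont : continuous eps)
  (eps_lim : eps x @[x --> at_infinity R n] --> (0 : R)) :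
  ~ exists g : 'rV[R]_n -> R,
      [/\ real_analytic g,
          @convex_function R 'rV[R]_n [set: 'rV[R]_n] g &
          forall x, `|f x - g x| <= eps x].
Proof.
move=> [g [ag cg fg]].
set i : 'I_n := Ordinal (ltnW hn) in hf.
pose j : 'I_n := Ordinal hn.
have galpha t : g (t *: delta_mx 0 i) = alpha t.
  pose phi s := g (t *: delta_mx 0 i + s *: delta_mx 0 j).
  suff <- : phi 0 = alpha t by rewrite /phi scale0r addr0.
  apply: midpoint_convex_eq_limit => [s u|e e0].
    rewrite /phi; apply: le_trans (convex_function_midpoint cg _ _).
    rewrite !scalerDr addrACA !scalerA -!scalerDl.
    by rewrite (_ : 2^-1 + 2^-1 = 1 :> R) ?scale1r//; lra.
  have := eps_lim _ (nbhsx_ballx 0 e e0) => -[M _ HM].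
  exists M => s Ms; pose x : 'rV[R]_n := t *: delta_mx 0 i + s *: delta_mx 0 j.
  have xi : x 0 i = t by rewrite !mxE !eqxx mulr1 mulr0 addr0.
  have xj : x 0 j = s by rewrite !mxE !eqxx mulr1 mulr0 add0r.
  have := fg x; rewrite hf xi => /le_trans; apply.
  (* The [j]-th coordinate alone drives [x] to infinity, whatever the fixed [t]. *)
  have /= : M < enorm x by apply: lt_le_trans Ms _; rewrite -xj ler_coord_enorm.
  move=> /HM /=; rewrite /ball /= sub0r normrN gtr0_norm//; exact: ltW.
have alpha0 t : 0 <= t -> alpha t = 0.
  apply: power_series_identity => [a|u /andP[u0 u1]].
    have := analytic_at_power_series (ag (a *: delta_mx 0 i)).
    by under eq_fun do rewrite galpha.
  by apply: alpha_in; rewrite ger0_norm.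
have := alpha_out 4; rewrite alpha0 ?ger0_norm//; lra.
Qed.
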